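(* Let $\kappa \geq \omega$ be a cardinal and let $\mathbb{S}$ be an $\omega_1$-Suslin tree. Assume that $2^{\omega} = \kappa^{++}$, that $\mathrm{MA}(\mathbb{S})$ holds, and that there exists a $\kappa^{+}$-Suslin tree. Then $\kappa^{+} \rightarrow (\kappa^{+}, (\omega:2))^2$, while $\kappa^{+} \not\rightarrow (\kappa^{+}, \omega+2)^2$.
   Context: A $\mu$-Suslin tree is a tree of size $\mu$ with no chains and no antichains of size $\mu$. $\mathrm{MA}(\mathbb{S})$ is the statement: whenever $\mathbb{P}$ is a poset such that $\mathbb{P}\times\mathbb{S}$ has the countable chain condition and $\{D_\alpha : \alpha < \mu\}$ are dense subsets of $\mathbb{P}$ with $\mu < 2^{\aleph_0}$ a cardinal, there is a filter $G \subset \mathbb{P}$ meeting every $D_\alpha$. For ordinals, $\alpha \rightarrow (\beta,\gamma)^2$ means: for every $c : [\alpha]^2 \to 2$ either there is $X \subset \alpha$ of order type $\beta$ with $c$ constantly $0$ on $[X]^2$, or there is $X\subset\alpha$ of order type $\gamma$ with $c$ constantly $1$ on $[X]^2$. $\alpha \rightarrow (\beta, (\gamma:\delta))^2$ means: for every $c : [\alpha]^2 \to 2$ either there is $X \subset \alpha$ of order type $\beta$ with $c$ constantly $0$ on $[X]^2$, or there are $A, B \subset \alpha$ of order types $\gamma$ and $\delta$ respectively such that $\zeta < \xi$ and $c(\{\zeta,\xi\}) = 1$ for all $\zeta \in A$, $\xi \in B$. $\not\rightarrow$ denotes negation. *)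

(* Defs.v *)
From HB Require Import structures.
From mathcomp Require Import all_boot all_order.
From mathcomp Require Import boolp classical_sets functions cardinality wochoice.

Set Implicit Arguments.
Unset Strict Implicit.
Unset Printing Implicit Defensive.

Import Order.Theory.

Local Open Scope classical_set_scope.
Local Open Scope card_scope.
Local Open Scope order_scope.

(* Ordinals are represented by well-ordered [orderType]s: omega is [nat], the
   finite ordinal n is ['I_n], and sums are given by [osum] below. *)

Definition osum (T1 T2 : Type) : Type := (T1 + T2)%type.

Section OrdinalSum.
Context {d1 d2 : Order.disp_t} (T1 : orderType d1) (T2 : orderType d2).

HB.instance Definition _ := Choice.copy (osum T1 T2) (T1 + T2)%type.

Definition osum_le : rel (osum T1 T2) := fun u v =>
  match u, v with
  | inl x, inl y => x <= y
  | inl _, inr _ => true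
  | inr _, inl _ => false
  | inr x, inr y => x <= y
  end.

Fact osum_le_refl : reflexive osum_le.
Proof. by case=> x /=. Qed.

Fact osum_le_anti : antisymmetric osum_le.
Proof.
by case=> x [] y //= => [/le_anti -> | /le_anti ->].
Qed.

Fact osum_le_trans : transitive osum_le.
Proof. by case=> y [] x [] z //=; apply: le_trans. Qed.

Fact osum_le_total : total osum_le.
Proof. by case=> x [] y //=; apply: le_total. Qed.

Fact osum_display : Order.disp_t.
Proof. exact: (Order.Disp tt tt). Qed.

HB.instance Definition _ :=
  Order.Le_isPOrder.Build osum_display (osum T1 T2)
    osum_le_refl osum_le_anti osum_le_trans.
HB.instance Definition _ :=
  Order.POrder_isTotal.Build osum_display (osum T1 T2) osum_le_total.

End OrdinalSum.

(* Cardinals are initial ordinals. *)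
Definition is_cardinal {d} (k : orderType d) : Prop :=
  well_order (<=%O : rel k) /\
  forall x : k, ~ ([set: k] #<= [set y | y < x]).

(* k' = k^+: a cardinal larger than k below which every ordinal has
   cardinality at most k. *)
Definition is_succ_cardinal {d d'} (k : orderType d) (k' : orderType d') :
    Prop :=
  [/\ is_cardinal k', ~ ([set: k'] #<= [set: k])
    & forall x : k', [set y | y < x] #<= [set: k]].

Definition continuum : set (nat -> bool) := [set: nat -> bool].

Definition has_order_type {d d'} {a : orderType d} (X : set a)
    (b : orderType d') : Prop :=
  exists f : b -> a, {mono f : x y / x <= y} /\ range f = X.

(* A colouring of the unordered pairs of [a] is represented by a binary
   function of which only the values [c x y] with [x < y] are used. *)
Definition homogeneous {d} {a : orderType d} (c : a -> a -> bool) (X : set a)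
    (i : bool) : Prop :=
  forall x y, X x -> X y -> x < y -> c x y = i.

(* a -> (b, g)^2 *)
Definition arrow {d d1 d2} (a : orderType d) (b : orderType d1)
    (g : orderType d2) : Prop :=
  forall c : a -> a -> bool,
    (exists X : set a, has_order_type X b /\ homogeneous c X false) \/
    (exists X : set a, has_order_type X g /\ homogeneous c X true).

(* a -> (b, (g : e))^2 *)
Definition arrow_colon {d d1 d2 d3} (a : orderType d) (b : orderType d1)
    (g : orderType d2) (e : orderType d3) : Prop :=
  forall c : a -> a -> bool,
    (exists X : set a, has_order_type X b /\ homogeneous c X false) \/
    (exists A B : set a, [/\ has_order_type A g, has_order_type B e
       & forall x y, A x -> B y -> x < y /\ c x y = true]).

Definition is_tree {d} (T : porderType d) : Prop :=
  forall t : T, wo_chain <=%O [pred s : T | s < t].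

Definition tree_chain {d} {T : porderType d} (C : set T) : Prop :=
  forall x y, C x -> C y -> x >=< y.

Definition tree_antichain {d} {T : porderType d} (A : set T) : Prop :=
  forall x y, A x -> A y -> x <> y -> x >< y.

Definition suslin_tree {d d'} (m : orderType d) (T : porderType d') : Prop :=
  [/\ is_tree T, [set: T] #= [set: m],
      forall C : set T, tree_chain C -> ~ (C #= [set: m])
    & forall A : set T, tree_antichain A -> ~ (A #= [set: m])].

(* Forcing convention: [p <= q] means that p is stronger than q. *)

Definition compatible {d} {P : porderType d} (p q : P) : Prop :=
  exists r : P, r <= p /\ r <= q.

Definition ccc {d} (P : porderType d) : Prop :=
  forall A : set P,
    (forall p q, A p -> A q -> p <> q -> ~ compatible p q) -> countable A.

Definition dense_set {d} {P : porderType d} (D : set P) : Prop :=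
  forall p : P, exists q : P, D q /\ q <= p.

Definition order_filter {d} {P : porderType d} (G : set P) : Prop :=
  [/\ G !=set0,
      forall p q, G p -> p <= q -> G q
    & forall p q, G p -> G q -> exists r, [/\ G r, r <= p & r <= q]].

(* A tree is used as a forcing notion with its order reversed (higher nodes
   are stronger conditions), hence the dual [S^d]; posets are nonempty. *)
Definition MA {d} (S : porderType d) : Prop :=
  forall (dP : Order.disp_t) (P : porderType dP),
    [set: P] !=set0 -> ccc (P *p S^d) ->
  forall (dm : Order.disp_t) (m : orderType dm),
    is_cardinal m -> ~ (continuum #<= [set: m]) ->
  forall D : m -> set P, (forall i, dense_set (D i)) ->
  exists G : set P, order_filter G /\ forall i, G `&` D i !=set0.

(* Main.v *)
(* Write E(a, b) for "a < b and c(a, b) = 1" and N(b) = {a | E(a, b)}.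

   Positive relation.  If it fails for c, then N(b) and N(b') have finite
   intersection whenever b <> b'.  Let P be the poset of finite c-homogeneous
   sets of colour 0.  In a hypothetical uncountable antichain of P x S one can
   find infinitely many conditions (p, s) and uncountably many conditions
   (q, s') with s below and s' above one fixed node t of S, since S has no
   uncountable antichain; each p is then joined by an edge to each q, which
   contradicts the finiteness of the intersections once the conditions are made
   disjoint.  So P x S is ccc, MA(S) applies to P below a condition forcing the
   generic set to be unbounded, and the generic set is homogeneous.

   Negative relation.  Attach distinct reals r_a to nodes e(a) of a kappa^+-Suslin
   tree all of whose cones are large, and above each e(a) fix an antichain
   y_a(s) indexed by finite binary words s.  With n the first place where r_a
   and r_b differ, put c(a, b) = 1 iff y_a(r_b | n + 1) <= e(b).  For
   u < v < w in a 1-homogeneous set, the first differences satisfy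
   D(u, v) = D(u, w) < D(v, w), so no such set has type omega + 2.  If X has
   size kappa^+, then for almost all a in X and every word s, the set X_s of the
   b in X whose real r_b extends s is either small above e(a) or large above
   every extension of e(a).  For such an a, some word s leaving r_a at its last
   place has X_s large above y_a(s), which yields an edge in X. *)
From HB Require Import structures.
Require Import Defs.
From mathcomp Require Import all_boot all_order finmap.
From mathcomp Require Import boolp classical_sets functions cardinality wochoice.

Set Implicit Arguments.
Unset Strict Implicit.
Unset Printing Implicit Defensive.

Import Order.Theory.

Local Open Scope classical_set_scope.
Local Open Scope card_scope.

(** * Well-founded recursion and cardinal arithmetic *)

Lemma well_order_wf (T : eqType) (R : rel T) :
  well_order R -> well_founded (fun x y => R x y && (x != y)).
Proof.
move=> Rwo; have Rwo' : wo_chain R predT by move=> A _; exact: Rwo.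
have Ranti := wo_chain_antisymmetric Rwo'.
move=> x; apply: contrapT => nax.
have [z [[/asboolP naz zmin] _]] := Rwo (fun x => `[< ~ Acc _ x >])
  (ex_intro _ x (asboolT nax)).
apply: naz; constructor=> y /andP[Ryz /eqP yz]; apply: contrapT => nay.
by apply: yz; apply: Ranti => //; rewrite Ryz zmin//; apply/asboolP.
Qed.

Lemma exists_well_order (T : choiceType) : exists lt : T -> T -> Prop,
  well_founded lt /\ forall x y, [\/ lt x y, x = y | lt y x].
Proof.
have [R Rwo] := well_ordering_principle T.
exists (fun x y => R x y && (x != y)); split; first exact: well_order_wf.
have Rwo' : wo_chain R predT by move=> A _; exact: Rwo.
move=> x y; case: (eqVneq x y) => [->|]; first by constructor 2.
move=> xy; have /orP[Rxy|Ryx] : R x y || R y x by exact: wo_chainW Rwo' _ _ isT isT.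
- by constructor 1; apply/andP.
- by constructor 3; apply/andP; split=> //; rewrite eq_sym.
Qed.

Lemma wf_asym T (lt : T -> T -> Prop) : well_founded lt ->
  forall x y, lt x y -> ~ lt y x.
Proof.
move=> wf; elim/(well_founded_ind wf) => x IH y xy yx.
exact: (IH _ yx _ yx xy).
Qed.

Lemma wf_trans T (lt : T -> T -> Prop) : well_founded lt ->
  (forall x y, [\/ lt x y, x = y | lt y x]) ->
  forall y x z, lt x y -> lt y z -> lt x z.
Proof.
move=> wf tri; have no_cycle x : forall y z, lt x y -> lt y z -> ~ lt z x.
  elim/(well_founded_ind wf) : x => x IH y z xy yz zx.
  exact: (IH _ zx _ _ zx xy yz).
move=> y x z xy yz; case: (tri x z) => // [e|/(no_cycle _ _ _ xy yz)//].
by exfalso; move: xy; rewrite e => zy; exact: (wf_asym wf yz zy).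
Qed.

(** Transfinite recursion with choice: [Q] constrains each value alone and [R] ties it to the
    earlier ones, so a construction reduces to a single extension step. *)
Lemma wf_choice W T (t0 : T) (lt : W -> W -> Prop) (Q : W -> T -> Prop)
    (R : W -> T -> W -> T -> Prop) :
  well_founded lt ->
  (forall x (f : W -> T), (forall y, lt y x -> Q y (f y)) ->
    exists h, Q x h /\ forall y, lt y x -> R y (f y) x h) ->
  exists f, forall x, Q x (f x) /\ forall y, lt y x -> R y (f y) x (f x).
Proof.
move=> wf step.
have /choice[next nextP] : forall xf : W * (W -> T), exists h,
    (forall y, lt y xf.1 -> Q y (xf.2 y)) ->
    Q xf.1 h /\ forall y, lt y xf.1 -> R y (xf.2 y) xf.1 h.
  move=> [x f]; case: (pselect (forall y, lt y x -> Q y (f y))) => [/step[h ?]|];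
    by [exists h|exists t0].
(* [Fix] supplies values only below [x]; the default [t0] makes them a total function. *)
pose ext x (g : forall y, lt y x -> T) y :=
  if pselect (lt y x) is left yx then g y yx else t0.
pose F := Fix wf (fun=> T) (fun x g => next (x, ext x g)).
have FE x : F x = next (x, ext x (fun y _ => F y)).
  rewrite {1}/F Fix_eq // => {}x f g fg; congr (next (x, _)).
  by apply/funext => y; rewrite /ext; case: pselect.
have extE x y : lt y x -> ext x (fun y _ => F y) y = F y.
  by rewrite /ext; case: pselect.
exists F; elim/(well_founded_ind wf) => x IH.
have /= [|Qx Rx] := nextP (x, ext x (fun y _ => F y)).
  by move=> y /= yx; rewrite extE//; have [] := IH _ yx.
by rewrite FE; split=> // y yx; have := Rx y yx; rewrite extE.
Qed.

(** * Comparison and arithmetic of cardinalities *)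

Lemma card_le_fun T U (f : T -> U) (A : set T) (B : set U) :
  (forall x, A x -> B (f x)) -> (forall x y, A x -> A y -> f x = f y -> x = y) ->
  A #<= B.
Proof.
move=> fAB finj; have /injfunPex[g] : exists2 f : T -> U, set_fun A B f & set_inj A f.
  by exists f => // x y /set_mem Ax /set_mem Ay; exact: finj.
exact: inj_card_le.
Qed.

Lemma card_leE T U (A : set T) (B : set U) (u0 : U) : A #<= B ->
  exists f : T -> U, (forall x, A x -> B (f x)) /\
    (forall x y, A x -> A y -> f x = f y -> x = y).
Proof.
move=> /card_leP[f].
exists (fun x => if pselect (A x) is left Ax then set_val (f (SigSub (mem_set Ax))) else u0).
split=> [x Ax|x y Ax Ay].
  by case: pselect => // Ax'; apply: set_valP.
case: pselect => // Ax'; case: pselect => // Ay' /val_inj /(@inj _ _ _ f).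
by move=> /(_ (mem_set I) (mem_set I)) [].
Qed.

Lemma card_leTE T U : [set: T] #<= [set: U] -> exists f : T -> U, injective f.
Proof.
move=> TU; case: (pselect (exists u : U, True)) => [[u0 _]|nU].
  by have [f [_ finj]] := card_leE u0 TU; exists f => x y; exact: finj.
have U0 : [set: U] = set0 by rewrite -subset0 => u _; apply: nU; exists u.
move: TU; rewrite U0 => /card_le0P T0.
have nT (t : T) : False by have : [set: T] t by []; rewrite T0.
by exists (fun t => False_rect _ (nT t)) => t; case: (nT t).
Qed.

(* Well-order U by r first; each b in B is then available at a stage u because
   fewer than |B| elements have been used. *)
Lemma card_le_rank (U V : choiceType) K (lt : K -> K -> Prop) (r : U -> K)
    (A : set U) (B : set V) :
  well_founded lt -> (forall x y, [\/ lt x y, x = y | lt y x]) ->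
  (forall u, A u -> ~ (B #<= [set u' | A u' /\ ~ lt (r u) (r u')])) ->
  A #<= B.
Proof.
move=> wf tri AB; have [->//|/set0P[a0 Aa0]] := eqVneq A set0.
have [b0 Bb0] : B !=set0.
  by apply: contrapT => /nonemptyPn B0; apply: (AB a0) => //; rewrite B0.
have [lU [wfU triU]] := exists_well_order U.
pose L u v := lt (r u) (r v) \/ (r u = r v /\ lU u v).
have wfL : well_founded L.
  suff h k : forall u, r u = k -> Acc L u by move=> u; exact: h erefl.
  elim/(well_founded_ind wf) : k => k IHk.
  elim/(well_founded_ind wfU) => u IHu ru; constructor => v [|[ruv uv]].
    by rewrite ru => /IHk/(_ v erefl).
  by apply: IHu => //; rewrite ruv.
have triL u v : [\/ L u v, u = v | L v u].
  case: (tri (r u) (r v)) => [||]; rewrite /L; [by constructor; left| |by constructor 3; left].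
  move=> ruv; case: (triU u v) => [uv|->|vu]; [|by constructor 2|];
    by [constructor 1; right|constructor 3; right].
have [f fP] : exists f : U -> V, forall x, (A x -> B (f x)) /\
    forall y, L y x -> (A y -> A x -> f y <> f x).
  apply: (@wf_choice _ _ b0 L (fun x h => A x -> B h)
    (fun y hy x hx => A y -> A x -> hy <> hx)) => // x f _.
  case: (pselect (A x)) => [Ax|nAx]; last by exists b0; split.
  apply: contrapT => nh; apply: (AB x Ax).
  have sub : B `<=` f @` [set y | A y /\ L y x].
    move=> b Bb; apply: contrapT => nb; apply: nh; exists b; split=> // y yx Ay _ fyb.
    by apply: nb; exists y.
  apply: (card_le_trans (subset_card_le sub)); apply: (card_le_trans (card_image_le _ _)).
  apply: subset_card_le => y [Ay yx]; split=> // xy; case: yx => [yx|[yx _]].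
    exact: (wf_asym wf xy yx).
  by rewrite yx in xy; exact: (wf_asym wf xy xy).
apply: (@card_le_fun _ _ f) => [x /(fP x).1//|x y Ax Ay fxy].
case: (triL x y) => // [xy|yx].
- by have := (fP y).2 x xy Ax Ay.
- by have := (fP x).2 y yx Ay Ax; rewrite fxy.
Qed.

(** With [id] as rank, every stage is a subset of [A], so it can exhaust [B] only if [B] embeds in
    [A]. *)
Lemma card_le_total (U V : choiceType) (A : set U) (B : set V) :
  A #<= B \/ B #<= A.
Proof.
have [lU [wfU triU]] := exists_well_order U.
case: (pselect (B #<= A)) => [|nBA]; [by right|left].
apply: (@card_le_rank _ _ _ _ id _ _ wfU triU) => u Au h; apply: nBA.
by apply: card_le_trans h _; apply: subset_card_le => y [].
Qed.

(** Hilbert's hotel: an injective sequence [g] in [A] is shifted by one, and [x] takes the place of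
    [g 0]. *)
Lemma card_le_setU1 (T : Type) (A : set T) x : infinite_set A -> x |` A #<= A.
Proof.
move=> /infiniteP nA; have [g [gA ginj]] := card_leE x nA.
case: (pselect (A x)) => [Ax|nAx].
  by apply: subset_card_le => y [->|].
pose f y := if pselect (y = x) then g 0%N else
  if pselect (exists n, y = g n) is left h then g (projT1 (cid h)).+1 else y.
have gE n m : g n = g m -> n = m by move=> /ginj; apply.
have fP y : [\/ y = x /\ f y = g 0%N, exists2 n, y = g n & f y = g n.+1
    | f y = y /\ forall n, y <> g n].
  rewrite /f; case: pselect => [yx|yx] /=; first by constructor 1.
  case: pselect => [h|h].
    by constructor 2; exists (projT1 (cid h)) => //; exact: projT2 (cid h).
  by constructor 3; split=> // n yn; apply: h; exists n.
apply: (@card_le_fun _ _ f) => [y xAy|y z _ _].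
  have [[_ fy]|[n _ fy]|[fy _]] := fP y; rewrite fy; try exact: gA.
  case: xAy => // yx; move: fy; rewrite yx /f; case: pselect => // ? <-; exact: gA.
have [[-> ->]|[n -> ->]|[-> yg]] := fP y; have [[-> ->]|[m -> ->]|[-> zg]] := fP z => //.
- by move=> /gE.
- by move=> e; case: (zg 0%N).
- by move=> /gE.
- by move=> /gE[->].
- by move=> e; case: (zg n.+1).
- by move=> e; case: (yg 0%N).
- by move=> e; case: (yg m.+1).
Qed.

Lemma card_leX T1 T2 U1 U2 (A1 : set T1) (A2 : set T2) (B1 : set U1) (B2 : set U2) :
  A1 #<= B1 -> A2 #<= B2 -> A1 `*` A2 #<= B1 `*` B2.
Proof.
move=> AB1 AB2.
case: (pselect (exists x : T1 * T2, (A1 `*` A2) x)) => [[[x1 x2] [/= Ax1 Ax2]]|nA]; last first.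
  suff -> : A1 `*` A2 = set0 by [].
  by rewrite -subset0 => x Ax; apply: nA; exists x.
have [u1 _] : B1 !=set0.
  apply: contrapT => /nonemptyPn B0; move: AB1; rewrite B0 => /card_le0P A10.
  by rewrite A10 in Ax1.
have [u2 _] : B2 !=set0.
  apply: contrapT => /nonemptyPn B0; move: AB2; rewrite B0 => /card_le0P A20.
  by rewrite A20 in Ax2.
have [f [fAB finj]] := card_leE u1 AB1; have [g [gAB ginj]] := card_leE u2 AB2.
apply: (@card_le_fun _ _ (fun x => (f x.1, g x.2))) => [[a b] [/= Aa Ab]|].
  by split; [exact: fAB|exact: gAB].
by move=> [a b] [c d] [/= Aa Ab] [/= Ac Ad] [/finj-> // /ginj->].
Qed.

(** Hessenberg's theorem, by induction on initial segments of a well-order. A set equinumerous with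
    a shorter segment inherits the claim from it ([trans]); otherwise every stage of the ordering of
    pairs is too small to exhaust the set ([initial]). *)
Lemma card_leXX (T : choiceType) : infinite_set [set: T] ->
  [set: T] `*` [set: T] #<= [set: T].
Proof.
have [lt [wf tri]] := exists_well_order T.
pose seg x := [set y | lt y x].
have trans (B C : set T) : B #<= C -> C #<= B ->
    (infinite_set C -> C `*` C #<= C) -> infinite_set B -> B `*` B #<= B.
  move=> BC CB hC /infiniteP nB; apply: (card_le_trans (card_leX BC BC)).
  by apply: card_le_trans CB; apply: hC; apply/infiniteP; exact: card_le_trans BC.
have initial (B : set T) :
    (forall x, B x -> infinite_set (seg x) -> seg x `*` seg x #<= seg x) ->
    (forall x, B x -> ~ (B #<= seg x)) -> infinite_set B -> B `*` B #<= B.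
  move=> hB nB Binf.
  (* Goedel's ordering: pairs are ranked by their maximum. *)
  pose r (p : T * T) := if pselect (lt p.1 p.2) then p.2 else p.1.
  apply: (@card_le_rank _ _ _ lt r) => // p [/= Bp1 Bp2] hp.
  set m := r p in hp; have Bm : B m by rewrite /m /r; case: pselect.
  have le_r (x : T) q : x = q.1 \/ x = q.2 -> ~ lt m (r q) -> (m |` seg m) x.
    move=> xq mq.
    have [mx|->|xm] := tri m x; [|by left|by right].
    exfalso; apply: mq; rewrite /r; case: xq => ?; subst x; case: pselect => //= h.
      exact: (wf_trans wf tri mx h).
    case: (tri q.1 q.2) => // [e|h']; first by rewrite /= e.
    exact: (wf_trans wf tri mx h').
  have {}hp : B #<= (m |` seg m) `*` (m |` seg m).
    apply: card_le_trans hp _; apply: subset_card_le => q [_ mq].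
    by split; apply: le_r mq; [left|right].
  case: (pselect (finite_set (seg m))) => segm.
    apply: Binf; apply: card_le_finite hp _.
    by apply: finite_setX; rewrite finite_setU; split.
  apply: (nB m Bm); apply: (card_le_trans hp).
  apply: (card_le_trans (card_leX (card_le_setU1 m segm) (card_le_setU1 m segm))).
  exact: hB.
have hseg x : infinite_set (seg x) -> seg x `*` seg x #<= seg x.
  elim/(well_founded_ind wf) : x => x IH.
  case: (pselect (exists2 y, lt y x & seg x #<= seg y)) => [[y yx sxy]|h].
    apply: (trans _ (seg y)) => //; last exact: IH.
    by apply: subset_card_le => z zy; exact: (wf_trans wf tri zy yx).
  by apply: initial => // y yx sxy; apply: h; exists y.
case: (pselect (exists y, [set: T] #<= seg y)) => [[y Ay]|h].
  by apply: (trans _ (seg y)) => //; [exact: card_leT|exact: hseg].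
by apply: initial => // [y _|y _ sxy]; [exact: hseg|apply: h; exists y].
Qed.

(** A point is coded by the index of a member containing it and its code there, that is, by a pair
    from [K]. *)
Lemma card_le_bigcup (K : choiceType) I T (D : set I) (F : I -> set T) :
  infinite_set [set: K] -> D #<= [set: K] -> (forall i, D i -> F i #<= [set: K]) ->
  \bigcup_(i in D) F i #<= [set: K].
Proof.
move=> Kinf DK FK; have [k0 _] := infinite_setN0 Kinf.
have [d [_ dinj]] := card_leE k0 DK.
have /choice[f fP] : forall i, exists f : T -> K, D i ->
    forall x y, F i x -> F i y -> f x = f y -> x = y.
  move=> i; case: (pselect (D i)) => [Di|nDi]; last by exists (fun=> k0).
  by have [f [_ ?]] := card_leE k0 (FK i Di); exists f.
apply: card_le_trans (card_leXX Kinf).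
case: (pselect (exists i, D i)) => [[i0 Di0]|nD]; last first.
  suff -> : \bigcup_(i in D) F i = set0 by [].
  by rewrite -subset0 => x [i Di _]; apply: nD; exists i.
have /choice[i iP] : forall x, exists i, (\bigcup_(i in D) F i) x -> D i /\ F i x.
  move=> x; case: (pselect ((\bigcup_(i in D) F i) x)) => [[i Di Fx]|?];
    by [exists i|exists i0].
apply: (@card_le_fun _ _ (fun x => (d (i x), f (i x) x))) => // x y.
move=> /iP[Dx Fx] /iP[Dy Fy] [/dinj -/(_ Dx Dy) ixy].
by rewrite -ixy; apply: (fP (i x)) => //; rewrite ixy.
Qed.

Lemma card_le_setU (K : choiceType) T (A B : set T) :
  infinite_set [set: K] -> A #<= [set: K] -> B #<= [set: K] ->
  A `|` B #<= [set: K].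
Proof.
move=> Kinf AK BK; rewrite -bigcup2E.
apply: card_le_bigcup => // [|[|[|i]]//= _].
by apply: card_le_trans (countableP _) _; exact/infiniteP.
Qed.

(** * Successor cardinals and Suslin trees *)

Local Open Scope order_scope.

Local Open Scope order_scope.

Lemma succ_cardinal_wf d d' (k : orderType d) (k1 : orderType d') :
  is_succ_cardinal k k1 -> well_founded (fun x y : k1 => x < y).
Proof.
move=> [[wo _] _ _]; elim/(well_founded_ind (well_order_wf wo)) => x IH.
by constructor => y yx; apply: IH; rewrite (ltW yx) (lt_eqF yx).
Qed.

Lemma lt_trichotomy d (k : orderType d) (x y : k) : [\/ x < y, x = y | y < x].
Proof. by case: (ltgtP x y); [constructor 1|constructor 3|constructor 2]. Qed.

Lemma succ_cardinal_le d d' (k : orderType d) (k1 : orderType d') (x : k1) :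
  [set: nat] #<= [set: k] -> is_succ_cardinal k k1 ->
  [set y | y <= x] #<= [set: k].
Proof.
move=> /infiniteP kinf [_ _ seg].
have : [set y | y < x] `|` [set x] #<= [set: k].
  apply: card_le_setU => //; apply: card_le_trans (countable1 x) _.
  exact/infiniteP.
apply: card_le_trans; apply: subset_card_le => y /=.
by rewrite le_eqVlt => /orP[/eqP ->|]; [right|left].
Qed.

(** Closed initial segments of [k1] have size at most [k], so a recursion along [k1] never exhausts
    a set that does not embed in [k]. *)
Lemma succ_cardinal_dichotomy d d' (k : orderType d) (k1 : orderType d')
    (T : choiceType) (A : set T) :
  [set: nat] #<= [set: k] -> is_succ_cardinal k k1 ->
  A #<= [set: k] \/ [set: k1] #<= A.
Proof.
move=> kinf k1P; case: (pselect (A #<= [set: k])) => [|nA]; [by left|right].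
apply: (@card_le_rank k1 T k1 (fun x y : k1 => x < y) id setT A).
- exact: succ_cardinal_wf k1P.
- exact: lt_trichotomy.
- move=> u _ Au; apply: nA; apply: card_le_trans Au _.
  apply: card_le_trans (succ_cardinal_le u kinf k1P).
  by apply: subset_card_le => y [_ /negP]; rewrite -leNgt.
Qed.

Section SuslinTree.
Context {d d1 dT : Order.disp_t} (k : orderType d) (k1 : orderType d1)
  (T : porderType dT).
Hypotheses (k_inf : [set: nat] #<= [set: k]) (k1_succ : is_succ_cardinal k k1).
Hypothesis T_suslin : suslin_tree k1 T.

(** The definition of a Suslin tree excludes only sets of size exactly [k1]; this turns the
    exclusion into the bound [k]. *)
Lemma suslin_small (A : set T) : ~ (A #= [set: k1]) -> A #<= [set: k].
Proof.
move=> AK1; have [//|K1A] := succ_cardinal_dichotomy A k_inf k1_succ.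
exfalso; apply: AK1; rewrite card_eq_le K1A andbT.
case: T_suslin => _ TK1 _ _; apply: card_le_trans (card_leT A) _.
by move: TK1; rewrite card_eq_le => /andP[].
Qed.

Lemma suslin_chain (C : set T) : tree_chain C -> C #<= [set: k].
Proof. by case: T_suslin => _ _ chK _ /chK; exact: suslin_small. Qed.

Lemma suslin_antichain (A : set T) : tree_antichain A -> A #<= [set: k].
Proof. by case: T_suslin => _ _ _ aK /aK; exact: suslin_small. Qed.

End SuslinTree.

(** * Minimal elements and cones in trees *)

Lemma tree_comparable d (T : porderType d) (x y t : T) :
  is_tree T -> x <= t -> y <= t -> x >=< y.
Proof.
move=> /(_ t)/wo_chainW tot; rewrite le_eqVlt => /orP[/eqP->|xt].
  by rewrite comparable_sym => /le_comparable.
rewrite le_eqVlt => /orP[/eqP->|yt]; first by rewrite lt_comparable.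
exact: tot.
Qed.

Definition minimals d (T : porderType d) (Z : set T) : set T :=
  [set m | Z m /\ forall z, Z z -> ~ z < m].

Lemma tree_minimals_le d (T : porderType d) (Z : set T) z :
  is_tree T -> Z z -> exists2 m, minimals Z m & m <= z.
Proof.
move=> Ttree Zz; case: (pselect (exists2 y, Z y & y < z)) => [[y Zy yz]|nz].
  have [|m [[/asboolP[Zm mz] mmin] _]] :=
      Ttree z (fun x => `[< Z x /\ x < z >]) _ (ex_intro _ y (asboolT (conj Zy yz))).
    by move=> x /asboolP[].
  exists m; last exact: ltW.
  split=> // x Zx xm; have /mmin : `[< Z x /\ x < z >].
    by apply/asboolP; split=> //; exact: lt_trans mz.
  by move=> /(lt_le_trans xm); rewrite ltxx.
by exists z => //; split=> // y Zy yz; apply: nz; exists y.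
Qed.

Lemma minimals_antichain d (T : porderType d) (Z : set T) :
  tree_antichain (minimals Z).
Proof.
move=> x y [Zx xmin] [Zy ymin] /eqP xy; apply/negP => /orP[xley|ylex].
- by apply: (ymin x) => //; rewrite lt_neqAle xy.
- by apply: (xmin y) => //; rewrite lt_neqAle eq_sym xy.
Qed.

(** The minimal elements of the image of [Z] form an antichain, and the cones above them cover
    [Z]. *)
Lemma tree_small_cones (K U : choiceType) d (T : porderType d) (f : U -> T)
    (Z : set U) :
  infinite_set [set: K] -> is_tree T ->
  (forall A : set T, tree_antichain A -> A #<= [set: K]) ->
  (forall z, Z z -> [set x | Z x /\ f z <= f x] #<= [set: K]) ->
  Z #<= [set: K].
Proof.
move=> Kinf Ttree aK cones; pose M := minimals (f @` Z).
have : \bigcup_(m in M) [set x | Z x /\ m <= f x] #<= [set: K].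
  apply: card_le_bigcup => //; first exact/aK/minimals_antichain.
  by move=> m [[z Zz <-] _]; exact: cones.
apply: card_le_trans; apply: subset_card_le => z Zz.
have [|m Mm mz] := @tree_minimals_le _ _ (f @` Z) (f z) Ttree; first by exists z.
by exists m.
Qed.

(** Only countably many points of [X] have finitely many predecessors. Among the others, some [y]
    has an uncountable cone by [tree_small_cones], and [t] is [f y]. *)
Lemma tree_split d (T : porderType d) (U : choiceType) (f : U -> T) (X : set U) :
  is_tree T -> (forall A : set T, tree_antichain A -> countable A) ->
  ~ countable X -> exists t,
    infinite_set [set x | X x /\ f x <= t] /\
    ~ countable [set x | X x /\ t <= f x].
Proof.
move=> Ttree aT Xunc; pose below x := [set y | X y /\ f y <= f x].
(* Elements with exactly n predecessors in X lie on an antichain. *)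
pose L n := [set x | X x /\ below x #= `I_n].
have Lcount n : countable (L n).
  have strict x y : L n x -> L n y -> ~ f x < f y.
    move=> [Xx bx] [Xy bY] xy.
    have fx : finite_set (below x) by exists n.
    have fy : finite_set (below y) by exists n.
    have : (fset_set (below x) `<` fset_set (below y))%fset.
      rewrite fproperEneq; apply/andP; split; last first.
        rewrite -fset_set_sub// => z [Xz zx]; split=> //.
        exact: le_trans (ltW xy).
      apply/eqP => /fset_set_inj bb.
      have [_] : below x y by rewrite bb//=; split.
      by move=> /(lt_le_trans xy); rewrite ltxx.
    move/fproper_ltn_card; rewrite (card_fset_set bx) (card_fset_set bY).
    by rewrite ltnn.
  (* [f] need not be injective, but the fibre of [f x] within [L n] lies in the finite set
     [below x]. *)
  have : countable (\bigcup_(t in f @` L n) [set x | L n x /\ f x = t]).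
    apply: bigcup_countable.
      apply: aT => _ _ [x Lx <-] [y Ly <-] /eqP xy; apply/negP => /orP[] h.
      - by apply: (strict x y) => //; rewrite lt_neqAle xy.
      - by apply: (strict y x) => //; rewrite lt_neqAle eq_sym xy.
    move=> _ [x [Xx bx] <-]; apply: finite_set_countable.
    apply: sub_finite_set (_ : finite_set (below x)); last by exists n.
    by move=> y [[Xy _] yx]; split=> //; rewrite yx.
  apply: sub_countable; apply: subset_card_le => x Lx.
  by exists (f x); [exists x|].
pose Y := X `\` \bigcup_n L n.
have Yunc : ~ countable Y.
  move=> Ycount; apply: Xunc; rewrite /countable.
  have : Y `|` \bigcup_n L n #<= [set: nat].
    by apply: card_le_setU => //; [exact: infinite_nat|exact: bigcup_countable].
  apply: card_le_trans; apply: subset_card_le => x Xx.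
  by case: (pselect ((\bigcup_n L n) x)); [right|left].
have [y [Yy cone]] : exists y, Y y /\ ~ countable [set x | Y x /\ f y <= f x].
  apply: contrapT => h; apply: Yunc.
  apply: (tree_small_cones (f := f) infinite_nat Ttree aT) => y Yy.
  by apply: contrapT => nc; apply: h; exists y; split.
exists (f y); split.
  by move=> [n yn]; case: Yy => Xy nL; apply: nL; exists n.
move=> c; apply: cone; apply: (sub_countable _ c); apply: subset_card_le.
by move=> x [[Xx _] yx]; split.
Qed.

(** * The chain condition for finite independent sets *)

Local Open Scope order_scope.

Lemma finite_subsingleton T (A : set T) :
  (forall x y, A x -> A y -> x = y) -> finite_set A.
Proof.
move=> A1; have [->|/set0P[x Ax]] := eqVneq A set0; first exact: finite_set0.
apply: sub_finite_set (finite_set1 x) => y Ay; exact: A1.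
Qed.

Definition independent (K : choiceType) (E : K -> K -> Prop) (p : {fset K}) :=
  forall a b, a \in p -> b \in p -> ~ E a b.

Section FreeSets.
Context (K : choiceType) (E : K -> K -> Prop) (d dw : Order.disp_t)
  (S : porderType d) (w1 : orderType dw).
Hypothesis E_fin :
  forall b b', b <> b' -> finite_set [set a | E a b /\ E a b'].
Hypotheses (S_tree : is_tree S)
  (S_antichain : forall A : set S, tree_antichain A -> countable A).
Hypothesis w1_succ : is_succ_cardinal nat w1.

Let cond : choiceType := ({fset K} * S)%type.

(** Compatibility in the product with the reversed tree: the union is again a condition and [t]
    extends both nodes. *)
Let good (X : set cond) := exists x y : cond,
  [/\ X x, X y, x <> y, independent E (x.1 `|` y.1)%fset
    & exists t, x.2 <= t /\ y.2 <= t].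

(** Pigeonhole: without a good pair, each condition below [t] is joined by an edge to each one above
    [t]. The sets are thinned out until a single [g m] must send edges to [n + 1] disjoint sets from
    distinct points. *)
Lemma disjoint_good (n : nat) (X : set cond) :
  (forall x, X x -> independent E x.1 /\ (#|` x.1| <= n)%N) ->
  (forall x y a, X x -> X y -> a \in x.1 -> a \in y.1 -> x = y) ->
  ~ countable X -> good X.
Proof.
move=> Xind Xdisj Xunc; apply: contrapT => nogood.
pose edge (x y : cond) := exists a b, [/\ a \in x.1, b \in y.1 & E a b].
have cross x y t : X x -> X y -> x <> y -> x.2 <= t -> t <= y.2 ->
    edge x y \/ edge y x.
  move=> Xx Xy xy xt ty; apply: contrapT => /not_orP[nxy nyx].
  apply: nogood; exists x, y; split=> //; last first.
    by exists y.2; split=> //; exact: le_trans ty.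
  move=> a b; rewrite !inE => /orP[ax|ay] /orP[bx|by_] Eab.
  - exact: (Xind x Xx).1 ax bx Eab.
  - by apply: nxy; exists a, b.
  - by apply: nyx; exists a, b.
  - exact: (Xind y Xy).1 ay by_ Eab.
have [t [A0inf Bunc]] := tree_split (U := cond) snd S_tree S_antichain Xunc.
have [[x0 _] /infiniteP A0nat] := (infinite_setN0 A0inf, A0inf).
have [g [gA ginj']] := card_leE x0 A0nat.
have {A0nat A0inf} gX m : X (g m) by have [] := gA m I.
have gt m : (g m).2 <= t by have [] := gA m I.
have ginj m m' : g m = g m' -> m = m' by exact: ginj'.
pose C := \bigcup_m [set` (g m).1].
have Ccount : countable C.
  by apply: bigcup_countable => // m _; exact: countable_fset.
pose Bad := \bigcup_(u in C `*` C) [set b | u.1 <> u.2 /\ (E b u.1 /\ E b u.2)].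
have Badcount : countable Bad.
  apply: bigcup_countable; first exact: countableX.
  move=> [u v] _ /=; case: (pselect (u = v)) => [->|uv].
    by rewrite (_ : [set _ | _] = set0)// -subset0 => b [].
  apply/finite_set_countable/sub_finite_set/(E_fin uv) => b []//.
(* Outside Bad, a point b has at most one u in C with E b u. *)
pose own := \bigcup_(b in Bad) [set y | X y /\ b \in y.1].
have owncount : countable own.
  apply: bigcup_countable => // b _; apply/finite_set_countable/finite_subsingleton.
  by move=> x y [Xx bx] [Xy bY]; exact: Xdisj bx bY.
(* Removing [range g] keeps [h k] distinct from every [g m], as [cross] requires. *)
pose B := [set x | X x /\ t <= x.2] `\` (own `|` range g).
have Binf : infinite_set B.
  move=> /finite_set_countable Bc; apply: Bunc; rewrite /countable.
  have : B `|` (own `|` range g) #<= [set: nat].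
    apply: card_le_setU => //; first exact: infinite_nat.
    apply: card_le_setU => //; first exact: infinite_nat.
    exact: card_image_le.
  apply: card_le_trans; apply: subset_card_le => x Xx.
  by case: (pselect ((own `|` range g) x)); [right|left].
have /infiniteP Bnat := Binf.
have [h [hB hinj]] := card_leE x0 Bnat.
have hX k : X (h k) by have [[]] := hB k I.
have ht k : t <= (h k).2 by have [[]] := hB k I.
have hbad k b : b \in (h k).1 -> ~ Bad b.
  by move=> bh Bb; have [_] := hB k I; apply; left; exists b.
have hg k m : g m <> h k.
  by move=> gh; have [_] := hB k I; apply; right; exists m.
(* F1: the finitely many u in C with E b u for some b in h 0, ..., h n;
   F2: the points with edges to two distinct points of h 0, ..., h n. *)
pose F1 := \bigcup_(k in `I_n.+1) \bigcup_(b in [set` (h k).1]) [set u | C u /\ E b u].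
have F1fin : finite_set F1.
  apply: bigcup_finite => [|k _]; first exact: finite_II.
  apply: bigcup_finite => [|b bh]; first exact: finite_fset.
  apply: finite_subsingleton => u v [Cu bu] [Cv bv].
  by apply: contrapT => uv; apply: (hbad k b bh); exists (u, v).
pose F2 := \bigcup_(kl in `I_n.+1 `*` `I_n.+1)
  \bigcup_(b in [set` (h kl.1).1] `*` [set` (h kl.2).1])
    [set a | b.1 <> b.2 /\ (E a b.1 /\ E a b.2)].
have F2fin : finite_set F2.
  apply: bigcup_finite => [|kl _]; first exact: finite_setX (finite_II _) (finite_II _).
  apply: bigcup_finite => [|b _]; first by apply: finite_setX; exact: finite_fset.
  case: (pselect (b.1 = b.2)) => [bb|bb].
    by rewrite (_ : [set _ | _] = set0)// -subset0 => a [].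
  by apply/sub_finite_set/(E_fin bb) => a [].
(* The sets [g m] are pairwise disjoint, so infinitely many of them cannot all meet a finite set. *)
have [m mF] : exists m, forall a, a \in (g m).1 -> ~ (F1 `|` F2) a.
  apply: contrapT => nm.
  have /choice[a aP] : forall m, exists a, a \in (g m).1 /\ (F1 `|` F2) a.
    move=> m; apply: contrapT => na; apply: nm; exists m => a ag Fa.
    by apply: na; exists a.
  have : finite_set (F1 `|` F2) by rewrite finite_setU.
  apply/infiniteP; apply: (@card_le_fun _ _ a) => [m _|m m' _ _ aa].
    exact: (aP m).2.
  by apply/ginj/(Xdisj _ _ (a m)); rewrite ?(aP m).1// aa (aP m').1.
have /choice[ub ubP] : forall k, exists ub : K * K, (k < n.+1)%N ->
    [/\ ub.1 \in (g m).1, ub.2 \in (h k).1 & E ub.1 ub.2].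
  move=> k; have [[a [b [ag bh Eab]]]|[b [u [bh ug Ebu]]]] :=
    cross _ _ t (gX m) (hX k) (hg k m) (gt m) (ht k).
    by exists (a, b).
  (* An edge from [h k] back to [g m] would put its end [u] in [F1]; the witness is a dummy. *)
  exists (u, u) => kn; exfalso; apply: (mF u ug); left.
  by exists k => //; exists b => //; split=> //; exists m.
(* Since g m avoids F2, the n + 1 sets h k are joined to distinct points of
   g m, which has at most n points. *)
have : `I_n.+1 #<= [set` (g m).1].
  apply: (@card_le_fun _ _ (fun k => (ub k).1)) => [k /ubP[]//|k l kn ln uu].
  apply: contrapT => kl.
  have [ukg bkh Ek] := ubP k kn; have [ulg blh El] := ubP l ln.
  apply: (mF _ ukg); right; exists (k, l) => //; exists ((ub k).2, (ub l).2) => //.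
  split=> /= [bb|]; last by rewrite {2}uu.
  apply/kl/hinj => //; apply: (Xdisj _ _ (ub k).2) => //.
  by rewrite bb.
have : [set` (g m).1] #= `I_#|` (g m).1| by apply/card_eq_fsetP.
rewrite card_eq_le => /andP[gle _] /card_le_trans/(_ gle).
by rewrite card_le_II ltnNge (Xind _ (gX m)).2.
Qed.

(** In place of a Delta-system lemma: a point lying in uncountably many conditions is removed and
    induction applies; if there is none, a recursion along [w1] selects uncountably many disjoint
    conditions. *)
Lemma sized_good (n : nat) (X : set cond) :
  (forall x, X x -> independent E x.1 /\ #|` x.1| = n) ->
  ~ countable X -> good X.
Proof.
elim: n X => [|n IHn] X Xind Xunc.
  apply: (@disjoint_good 0) => // [x /Xind[? ->]//|x y a Xx _ ax _].
  by have [_ /eqP] := Xind x Xx; rewrite cardfs_eq0 => /eqP x0; rewrite x0 in ax.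
case: (pselect (exists a, ~ countable [set x | X x /\ a \in x.1])) => [[a aunc]|na].
  pose rm (x : cond) : cond := ((x.1 `\ a)%fset, x.2).
  have [|nc|x' [y' [[x [Xx ax] <-] [y [Xy ay] <-] xy ind [t [xt yt]]]]] :=
      IHn (rm @` [set x | X x /\ a \in x.1]).
  - move=> _ [x [Xx ax] <-]; have [xind xn] := Xind x Xx; split.
      by move=> b c; rewrite !inE => /andP[_ bx] /andP[_ cx]; exact: xind.
    by move: xn; rewrite (cardfsD1 a) ax add1n => -[].
  - apply: aunc; apply: sub_countable nc.
    suff : rm @` [set x | X x /\ a \in x.1] #= [set x | X x /\ a \in x.1].
      by rewrite card_eq_le => /andP[].
    apply: inj_card_eq => [[p s] [q u]] /set_mem[_ /= ap] /set_mem[_ /= aq] [pq ->].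
    by rewrite -(fsetD1K ap) pq fsetD1K.
  exists x, y; split=> //; [by move=> e; apply: xy; rewrite e| |by exists t].
  have xind := (Xind x Xx).1; have yind := (Xind y Xy).1.
  have rmP (z : cond) b : b \in z.1 -> b = a \/ b \in (rm z).1.
    by move=> bz; rewrite !inE bz; case: eqVneq; [left|right].
  (* Since [a] belongs to both sets, an edge at [a] would lie inside one of them. *)
  have away b : b \in (x.1 `|` y.1)%fset -> ~ E a b /\ ~ E b a.
    by rewrite inE => /orP[bx|bY]; split; [exact: xind|exact: xind|exact: yind|exact: yind].
  move=> b c bxy cxy.
  have [->|ba] := eqVneq b a; first exact: (away c cxy).1.
  have [->|ca] := eqVneq c a; first exact: (away b bxy).2.
  by apply: ind; move: bxy cxy; rewrite !inE ?ba ?ca.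
have Xcount a : countable [set x | X x /\ a \in x.1].
  by apply: contrapT => aunc; apply: na; exists a.
have [x0 _] : X !=set0 by apply/set0P/eqP => X0; apply: Xunc; rewrite X0.
have [f fP] : exists f : w1 -> cond, forall i, X (f i) /\
    forall j, j < i -> forall a, a \in (f j).1 -> a \notin (f i).1.
  apply: (@wf_choice w1 cond x0 (fun i j => i < j) (fun i x => X x)
    (fun j y i x => forall a, a \in y.1 -> a \notin x.1)).
    exact: succ_cardinal_wf w1_succ.
  move=> i f _; apply: contrapT => nf; apply: Xunc.
  have : countable (\bigcup_(j in [set j | j < i])
      \bigcup_(a in [set` (f j).1]) [set x | X x /\ a \in x.1]).
    apply: bigcup_countable => [|j _]; first by case: w1_succ => _ _ /(_ i).
    by apply: bigcup_countable => [|a _]; [exact: countable_fset|exact: Xcount].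
  apply: sub_countable; apply: subset_card_le => x Xx; apply: contrapT => nx.
  apply: nf; exists x; split=> // j ji a aj; apply/negP => ax.
  by apply: nx; exists j => //; exists a.
have fdisj i j a : a \in (f i).1 -> a \in (f j).1 -> i = j.
  move=> ai aj; case: (ltgtP i j) => // ij.
  - by have := (fP j).2 i ij a ai; rewrite aj.
  - by have := (fP i).2 j ij a aj; rewrite ai.
have [|||x [y [[i _ <-] [j _ <-] ij ind xy]]] := @disjoint_good n.+1 (range f).
- by move=> _ [i _ <-]; have [? ->] := Xind _ (fP i).1.
- by move=> _ _ a [i _ <-] [j _ <-] ai aj; rewrite (fdisj i j a).
- move=> fc; case: w1_succ => _ + _; apply; apply: sub_countable fc.
  apply: (@card_le_fun _ _ f) => [i _|i j _ _ fij]; first by exists i.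
  have [a ai] : exists a, a \in (f i).1.
    by apply/fset0Pn; rewrite -cardfs_eq0 (Xind _ (fP i).1).2.
  by apply: (fdisj i j a) => //; rewrite -fij.
by exists (f i), (f j); split=> //; exact: (fP _).1.
Qed.

Lemma uncountable_good (X : set cond) :
  (forall x, X x -> independent E x.1) -> ~ countable X -> good X.
Proof.
move=> Xind Xunc.
have [n nX] : exists n, ~ countable [set x | X x /\ #|` x.1| = n].
  apply: contrapT => h; apply: Xunc.
  have : countable (\bigcup_n [set x | X x /\ #|` x.1| = n]).
    apply: bigcup_countable => // n _.
    by apply: contrapT => hn; apply: h; exists n.
  by apply: sub_countable; apply: subset_card_le => x Xx; exists #|` x.1|.
have [|x [y [[Xx _] [Xy _] *]]] := sized_good (n := n) _ nX.
  by move=> x [Xx xn]; split=> //; exact: Xind.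
by exists x, y.
Qed.
End FreeSets.

(** * The positive relation *)

Local Open Scope order_scope.

(** * Bounded and unbounded subsets of a successor cardinal *)

Section SuccessorCardinal.
Context {d d1 : Order.disp_t} (k : orderType d) (k1 : orderType d1).
Hypotheses (k_inf : [set: nat] #<= [set: k]) (k1_succ : is_succ_cardinal k k1).

Lemma succ_cardinal_nonempty : [set: k1] !=set0.
Proof.
apply/set0P/eqP => k10; case: k1_succ => _ + _; apply.
by rewrite k10.
Qed.

(** Regularity of the successor: an unbounded [Y] of size at most [k] would cover [k1] by [k] many
    segments of size at most [k]. *)
Lemma succ_cardinal_bounded (Y : set k1) : Y #<= [set: k] ->
  exists h, forall y, Y y -> y < h.
Proof.
move=> Yk; apply: contrapT => nh; case: k1_succ => _ + _; apply.
have : \bigcup_(y in Y) [set x | x <= y] #<= [set: k].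
  apply: card_le_bigcup => //; first exact/infiniteP.
  by move=> y _; exact: succ_cardinal_le.
apply: card_le_trans; apply: subset_card_le => h _; apply: contrapT => nY.
apply: nh; exists h => y Yy; rewrite ltNge; apply/negP => hy.
by apply: nY; exists y.
Qed.

Lemma unbounded_order_type (H : set k1) :
  (forall x, exists2 h, H h & x <= h) ->
  exists X, X `<=` H /\ has_order_type X k1.
Proof.
move=> Hunb; have [x0 _] := succ_cardinal_nonempty.
have [f fP] : exists f : k1 -> k1, forall x, H (f x) /\ forall y, y < x -> f y < f x.
  apply: (@wf_choice k1 k1 x0 (fun x y => x < y) (fun _ h => H h)
    (fun _ hy _ hx => hy < hx)); first exact: succ_cardinal_wf k1_succ.
  move=> x f _; have [|b bP] := @succ_cardinal_bounded (f @` [set y | y < x]).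
    by apply: card_le_trans (card_image_le _ _) _; case: k1_succ.
  have [h Hh bh] := Hunb b; exists h; split=> // y yx.
  by apply: lt_le_trans bh; apply: bP; exists y.
exists (range f); split=> [_ [x _ <-]|]; first exact: (fP x).1.
by exists f; split=> //; apply: le_mono => y x /(fP x).2.
Qed.

Lemma infinite_order_type_nat (Z : set k1) : infinite_set Z ->
  exists A, A `<=` Z /\ has_order_type A nat.
Proof.
move=> Zinf.
have [W [WZ Winf Wfin]] : exists W, [/\ W `<=` Z, infinite_set W &
    forall z, W z -> finite_set [set y | W y /\ y < z]].
  (* Below the least x with infinitely many predecessors in Z, the set Z has
   order type omega. *)
  pose inf x := infinite_set [set y | Z y /\ y < x].
  case: (pselect (exists x, inf x)) => [[x infx]|ninf]; last first.
    by exists Z; split=> // z _; apply: contrapT => h; apply: ninf; exists z.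
  elim/(well_founded_ind (succ_cardinal_wf k1_succ)) : x infx => x IH infx.
  case: (pselect (exists2 y, y < x & inf y)) => [[y yx infy]|h]; first exact: IH infy.
  exists [set y | Z y /\ y < x]; split=> // [y []//|z [Zz zx]].
  apply: contrapT => hz; apply: h; exists z => // fz; apply: hz.
  by apply: sub_finite_set fz => y [[]].
(* [W] has no maximum, as its initial segments are finite; iterating [next] gives an increasing
   sequence. *)
have /choice[next nextP] : forall z, exists z', W z -> W z' /\ z < z'.
  move=> z; case: (pselect (W z)) => [Wz|]; last by exists z.
  apply: contrapT => nz; apply: Winf.
  apply: (@sub_finite_set _ _ ([set y | W y /\ y < z] `|` [set z])).
    move=> y Wy /=; have [yz|<-|zy] := lt_trichotomy y z; [by left|by right|].
    by exfalso; apply: nz; exists y.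
  by rewrite finite_setU; split=> //; exact: Wfin.
have [z0 Wz0] := infinite_setN0 Winf.
pose f n := iter n next z0.
have fW n : W (f n) by elim: n => //= n /nextP[].
exists (range f); split=> [_ [n _ <-]|]; first exact/WZ/fW.
exists f; split=> //; apply: le_mono; apply: homo_ltn; first exact: lt_trans.
by move=> n; have [] := nextP _ (fW n).
Qed.

End SuccessorCardinal.

(** * The poset of finite independent sets *)

Section Conditions.
Context (K : choiceType) (E : K -> K -> Prop) (p0 : {fset K}).

(** Only conditions below [p0] are kept, so that a suitable [p0] makes the generic set unbounded.
    The boolean predicate gives a subtype with a choice structure. *)
Definition condition : Type :=
  {q : {fset K} | `[< (p0 `<=` q)%fset /\ independent E q >]}.

HB.instance Definition _ := Choice.on condition.

Definition condition_le : rel condition := fun p q => (val q `<=` val p)%fset.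

Fact condition_le_refl : reflexive condition_le.
Proof. by move=> p; exact: fsubset_refl. Qed.

Fact condition_le_anti : antisymmetric condition_le.
Proof. by move=> p q pq; apply/val_inj/eqP; rewrite eqEfsubset andbC. Qed.

Fact condition_le_trans : transitive condition_le.
Proof. by move=> p q r qp pr; exact: fsubset_trans pr qp. Qed.

Fact condition_display : Order.disp_t. Proof. exact: (Order.Disp tt tt). Qed.

HB.instance Definition _ := Order.Le_isPOrder.Build condition_display condition
  condition_le_refl condition_le_anti condition_le_trans.

Lemma condition_leE (p q : condition) : (p <= q) = (val q `<=` val p)%fset.
Proof. by []. Qed.

Lemma conditionP (q : condition) :
  (p0 `<=` val q)%fset /\ independent E (val q).
Proof. exact/asboolP/(valP q). Qed.

Lemma exists_condition (q : {fset K}) : (p0 `<=` q)%fset -> independent E q ->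
  exists r : condition, val r = q.
Proof. by move=> pq qind; exists (exist _ q (asboolT (conj pq qind))). Qed.

End Conditions.

Section PositiveRelation.
Context {d d1 dw dS : Order.disp_t} (k : orderType d) (k1 : orderType d1)
  (w1 : orderType dw) (S : porderType dS).
Hypotheses (k_inf : [set: nat] #<= [set: k]) (k1_succ : is_succ_cardinal k k1).
Hypotheses (w1_succ : is_succ_cardinal nat w1) (S_suslin : suslin_tree w1 S).

Let S_antichain (A : set S) : tree_antichain A -> countable A.
Proof. exact: (suslin_antichain (card_lexx _) w1_succ S_suslin). Qed.

Let S_tree : is_tree S. Proof. by case: S_suslin. Qed.

Lemma condition_ccc (E : k1 -> k1 -> Prop) (p0 : {fset k1}) :
  (forall b b', b <> b' -> finite_set [set a | E a b /\ E a b']) ->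
  ccc (condition E p0 *p S^d).
Proof.
move=> Efin A Aanti; apply: contrapT => Aunc.
pose F (x : condition E p0 * S) := (val x.1, x.2).
have [|Fc|_ [_ [[x Ax <-] [y Ay <-] xy ind [t [xt yt]]]]] :=
    @uncountable_good k1 E _ _ S w1 Efin S_tree S_antichain w1_succ (F @` A).
- by move=> _ [x _ <-]; have [] := conditionP x.1.
- apply: Aunc; apply: sub_countable Fc.
  suff : F @` A #= A by rewrite card_eq_le => /andP[].
  by apply: inj_card_eq => -[p s] [q u] _ _ [/val_inj-> ->].
apply: (Aanti x y Ax Ay) => [e|]; first by apply: xy; rewrite e.
have [|r rE] := @exists_condition _ E p0 _ _ ind.
  by apply: fsubset_trans (conditionP x.1).1 (fsubsetUl _ _).
exists (r, t); split; apply/andP; split=> //=;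
  by rewrite condition_leE rE ?fsubsetUl ?fsubsetUr.
Qed.

(** Otherwise every singleton has an extension [qb] whose further extensions are all bounded.
    Choosing [w1] many points, each beyond the earlier bounds, gives uncountably many pairwise
    incompatible conditions. All carry the same node [s0], so the tree cannot be what separates
    them. *)
Lemma exists_unbounded_condition (E : k1 -> k1 -> Prop) :
  (forall b b', b <> b' -> finite_set [set a | E a b /\ E a b']) ->
  (forall a, ~ E a a) ->
  exists p, independent E p /\ forall q x, (p `<=` q)%fset -> independent E q ->
    exists r, [/\ (q `<=` r)%fset, independent E r & exists2 y, y \in r & x <= y].
Proof.
move=> Efin Eirr; apply: contrapT => np.
have /choice[qb qbP] : forall a, exists qb : {fset k1} * k1, [/\ a \in qb.1,
    independent E qb.1 & forall r y, (qb.1 `<=` r)%fset -> independent E r ->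
      y \in r -> y < qb.2].
  move=> a; apply: contrapT => nq; apply: np; exists [fset a]%fset; split.
    by move=> ? ? /fset1P-> /fset1P->.
  move=> q x aq qind; apply: contrapT => nr; apply: nq; exists (q, x); split=> //=.
    by apply: (fsubsetP aq); rewrite inE.
  move=> r y qr rind yr; rewrite ltNge; apply/negP => xy; apply: nr.
  by exists r; split=> //; exists y.
have [s0 _] : [set: S] !=set0.
  apply/set0P/eqP => S0; case: (w1_succ) => _ + _; apply.
  by case: S_suslin; rewrite S0 card_eq_sym card_eq0 => _ /eqP ->.
have [x0 _] := succ_cardinal_nonempty k1_succ.
have [f fP] : exists f : w1 -> k1, forall i, True /\
    forall j, j < i -> (qb (f j)).2 <= f i.
  apply: (@wf_choice w1 k1 x0 (fun i j => i < j) (fun _ _ => True)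
    (fun _ hj _ hi => (qb hj).2 <= hi)); first exact: succ_cardinal_wf w1_succ.
  move=> i f _.
  have [|h hP] := @succ_cardinal_bounded _ _ k k1 k_inf k1_succ
      ((fun j => (qb (f j)).2) @` [set j | j < i]).
    apply: card_le_trans (card_image_le _ _) _; apply: card_le_trans k_inf.
    by case: w1_succ.
  by exists h; split=> // j ji; apply/ltW/hP; exists j.
have no_ext i j r : i < j -> ((qb (f i)).1 `<=` r)%fset -> f j \in r ->
    independent E r -> False.
  move=> ij ir jr rind; have [_ _ /(_ r _ ir rind jr)] := qbP (f i).
  by rewrite ltNge (fP j).2.
pose F i := ((qb (f i)).1, s0).
have fq j : f j \in (qb (f j)).1 by have [] := qbP (f j).
have qind j : independent E (qb (f j)).1 by have [] := qbP (f j).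
have [|Fc|_ [_ [[i _ <-] [j _ <-] xy ind _]]] :=
    @uncountable_good k1 E _ _ S w1 Efin S_tree S_antichain w1_succ (range F).
- by move=> _ [i _ <-]; exact: qind.
- case: (w1_succ) => _ + _; apply; apply: sub_countable Fc.
  apply: (@card_le_fun _ _ F) => [i _|i j _ _ [qq]]; first by exists i.
  case: (ltgtP i j) => // ij; exfalso.
  - by apply: (no_ext i j _ ij) (qind j) => //; rewrite qq.
  - by apply: (no_ext j i _ ij) (qind i) => //; rewrite qq.
- case: (ltgtP i j) => ij; last by apply: xy; rewrite ij.
  - by apply: (no_ext i j _ ij _ _ ind); rewrite ?fsubsetUl// inE fq orbT.
  - by apply: (no_ext j i _ ij _ _ ind); rewrite ?fsubsetUr// inE fq.
Qed.

Lemma MA_arrow_colon : is_cardinal k1 -> ~ (continuum #<= [set: k1]) -> MA S ->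
  arrow_colon k1 k1 nat 'I_2.
Proof.
move=> k1_card k1_cont MA_S c.
have [|noAB] := pselect (exists A B : set k1, [/\ has_order_type A nat,
  has_order_type B 'I_2 & forall x y, A x -> B y -> x < y /\ c x y = true]).
  by right.
left; pose E a b := a < b /\ c a b.
have Efin b b' : b <> b' -> finite_set [set a | E a b /\ E a b'].
  wlog bb' : b b' / b < b' => [hwlog|_].
    have [|->//|b'b bb] := lt_trichotomy b b'; first exact: hwlog.
    by rewrite (_ : [set _ | _] = [set a | E a b' /\ E a b]);
      [apply: hwlog => //; exact/nesym|apply/seteqP; split=> a []].
  (* An infinite set of common neighbours contains a set of type omega; together with the pair
     [b < b'] it is excluded by [noAB]. *)
  apply: contrapT => inf; apply: noAB.
  have [A [AE Anat]] := infinite_order_type_nat k1_succ inf.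
  pose f (i : 'I_2) := if i == ord0 then b else b'.
  exists A, (range f); split=> //.
    exists f; split=> //; apply: le_mono => -[[|[|//]] ?] [[|[|//]] ?] //.
  move=> x _ /AE[[xb cb] [xb' cb']] [i _ <-]; rewrite /f.
  by case: ifP.
have Eirr a : ~ E a a by case; rewrite ltxx.
have [p [pind pP]] := exists_unbounded_condition Efin Eirr.
pose D (x : k1) := [set q : condition E p | exists2 y, y \in val q & x <= y].
have [||G [[_ _ Gdir] GD]] := MA_S _ (condition E p) _ (condition_ccc Efin) _ k1 k1_card k1_cont D.
- by have [r _] := exists_condition (fsubset_refl p) pind; exists r.
- move=> x q; have [pq qind] := conditionP q.
  have [r [qr rind rx]] := pP _ x pq qind.
  have [r' rE] := exists_condition (fsubset_trans pq qr) rind.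
  by exists r'; rewrite condition_leE /D /= rE.
have [|X [XH Xk1]] := @unbounded_order_type _ _ k k1 k_inf k1_succ
  [set a | exists2 q, G q & a \in val q].
  move=> x; have [q [Gq [y yq xy]]] := GD x.
  by exists y => //; exists q.
exists X; split=> // x y /XH[q Gq xq] /XH[q' Gq' yq'] xy.
(* Two points of the generic set lie in one condition, so no edge joins them. *)
have [r [Gr rq rq']] := Gdir _ _ Gq Gq'.
apply/negP => cxy; have [_ rind] := conditionP r.
by apply: (rind x y) => //; [exact: (fsubsetP rq)|exact: (fsubsetP rq')].
Qed.

End PositiveRelation.

(** * The negative relation *)

Local Open Scope order_scope.

Lemma eq_mkseq_prefix T (f g : nat -> T) n m : mkseq f n = mkseq g m ->
  n = m /\ forall i, (i < n)%N -> f i = g i.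
Proof.
move=> fg; have nm : n = m by have := congr1 size fg; rewrite !size_mkseq.
split=> // i lt_in; have := congr1 (fun s => nth (f i) s i) fg.
by rewrite !nth_mkseq// -nm.
Qed.

Definition first_difference (x y : nat -> bool) n :=
  (forall i, (i < n)%N -> x i = y i) /\ x n <> y n.

Lemma exists_first_difference x y : x <> y -> exists n, first_difference x y n.
Proof.
move=> xy; have ex : exists n, x n != y n.
  apply: contrapT => h; apply: xy; apply/funext => n.
  by apply: contrapT => /eqP xyn; apply: h; exists n.
exists (ex_minn ex); case: ex_minnP => n /eqP xyn nmin; split=> // i lt_in.
by apply: contrapT => /eqP/nmin; rewrite leqNgt lt_in.
Qed.

Section SuslinColouring.
Context {d d1 dT : Order.disp_t} (k : orderType d) (k1 : orderType d1)
  (T : porderType dT).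
Hypotheses (k_inf : [set: nat] #<= [set: k]) (k1_succ : is_succ_cardinal k k1).
Hypothesis T_suslin : suslin_tree k1 T.

Let k_infinite : infinite_set [set: k]. Proof. exact/infiniteP. Qed.
Let T_tree : is_tree T. Proof. by case: T_suslin. Qed.
Let T_antichain (A : set T) : tree_antichain A -> A #<= [set: k].
Proof. exact: (suslin_antichain k_inf k1_succ T_suslin). Qed.
Let T_chain (A : set T) : tree_chain A -> A #<= [set: k].
Proof. exact: (suslin_chain k_inf k1_succ T_suslin). Qed.

Definition large_cone (t : T) := ~ ([set s | t <= s] #<= [set: k]).

Lemma card_small_cones : [set t | ~ large_cone t] #<= [set: k].
Proof.
apply: (tree_small_cones (f := id) k_infinite T_tree T_antichain) => t /contrapT.
by apply: card_le_trans; apply: subset_card_le => s [].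
Qed.

(** If the large nodes above [t] formed a chain, they would number at most [k], and so would the
    whole cone, the nodes with small cones being few. *)
Lemma large_cone_split t : large_cone t ->
  exists a s, [/\ t <= a, t <= s, a >< s & large_cone s].
Proof.
move=> tlarge; pose C := [set s | t <= s /\ large_cone s].
have : ~ tree_chain C.
  move=> /T_chain Ck; apply: tlarge.
  have : C `|` [set t | ~ large_cone t] #<= [set: k].
    by apply: card_le_setU => //; exact: card_small_cones.
  apply: card_le_trans; apply: subset_card_le => s ts.
  by case: (pselect (large_cone s)); [left|right].
move=> nC; apply: contrapT => h; apply: nC => a s [ta _] [ts slarge].
by apply: contrapT => /negP as_; apply: h; exists a, s.
Qed.

(** The nodes [s n] climb through large cones and [y n] branches off at [s n]: it is incomparable
    with [s n.+1], which lies below all later [y m]. *)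
Lemma large_cone_antichain t : large_cone t -> exists y : nat -> T,
  (forall n, t <= y n) /\ forall n m w, y n <= w -> y m <= w -> n = m.
Proof.
move=> tlarge.
have /choice[next nextP] : forall s, exists as' : T * T, large_cone s ->
    [/\ s <= as'.1, s <= as'.2, as'.1 >< as'.2 & large_cone as'.2].
  move=> s; case: (pselect (large_cone s)) => [/large_cone_split[a [s' h]]|];
    by [exists (a, s')|exists (s, s)].
pose s n := iter n (fun s => (next s).2) t.
have slarge n : large_cone (s n) by elim: n => //= n /nextP[].
have sle n m : (n <= m)%N -> s n <= s m.
  elim: m => [|m IH]; first by rewrite leqn0 => /eqP ->.
  rewrite leq_eqVlt => /orP[/eqP -> //|/IH nm]; apply: (le_trans nm).
  by have [] := nextP _ (slarge m).
pose y n := (next (s n)).1.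
have sy n : s n <= y n by have [] := nextP _ (slarge n).
exists y; split=> [n|n m w].
  by apply: le_trans (sy n); exact: (sle 0%N).
have ylt i j : (i < j)%N -> y i <= w -> y j <= w -> False.
  move=> ij yiw yjw; have [_ _ + _] := nextP _ (slarge i); apply/negP; rewrite negbK.
  apply: (tree_comparable T_tree yiw); apply: le_trans yjw.
  exact: le_trans (sle _ _ ij) (sy j).
by case: (ltngtP n m) => // /ylt h yn ym; case: h.
Qed.

(** A node outside [O] lies below a minimal element of [O], so the complement is covered by at most
    [k] many chains. *)
Lemma card_setC_dense_open (O : set T) :
  (forall x y, O x -> x <= y -> O y) -> (forall x, exists2 y, O y & x <= y) ->
  ~` O #<= [set: k].
Proof.
move=> Oopen Odense.
have : \bigcup_(m in minimals O) [set x | x <= m] #<= [set: k].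
  apply: card_le_bigcup => //; first exact/T_antichain/minimals_antichain.
  by move=> m _; apply: T_chain => x y xm ym; exact: tree_comparable xm ym.
apply: card_le_trans; apply: subset_card_le => x nOx.
have [z Oz xz] := Odense x; have [m [Om mmin] mz] := tree_minimals_le T_tree Oz.
exists m; first by split.
have /orP[//|mx] := tree_comparable T_tree xz mz.
by case: nOx; exact: Oopen mx.
Qed.

Section Colouring.
Context (r : k1 -> nat -> bool) (e : k1 -> T) (y : k1 -> seq bool -> T).
Hypotheses (r_inj : injective r) (e_inj : injective e).
Hypothesis y_above : forall a s, e a <= y a s.
Hypothesis y_disj : forall a s s' w, y a s <= w -> y a s' <= w -> s = s'.

Definition coloured n (a b : k1) :=
  first_difference (r a) (r b) n /\ y a (mkseq (r b) n.+1) <= e b.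

Definition suslin_colouring (a b : k1) : bool := `[< exists n, coloured n a b >].

(** Both nodes chosen above [e u] lie below [e w], so their words coincide: [r v] and [r w] agree
    through place [n]. *)
Lemma coloured_triangle u v w n n' m :
  coloured n u v -> coloured n' u w -> coloured m v w -> n = n' /\ (n < m)%N.
Proof.
move=> [uv yuv] [uw yuw] [[_ vw] yvw].
have vwle : e v <= e w by exact: le_trans (y_above _ _) yvw.
have /eq_mkseq_prefix[[nn'] vwn] := y_disj (le_trans yuv vwle) yuw.
by split=> //; rewrite ltnNge; apply/negP => mn; apply/vw/vwn.
Qed.

(** The first differences [N i] between the omega part and [t0] increase strictly, yet stay below
    the first difference [M] of [t0] and [t1]. *)
Lemma suslin_colouring_no_omega2 (X : set k1) :
  has_order_type X (osum nat 'I_2) -> ~ homogeneous suslin_colouring X true.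
Proof.
move=> [g [gmono gX]] Xhom.
have glt := leW_mono gmono.
have gc a b : a < b -> exists n, coloured n (g a) (g b).
  move=> ab; apply/asboolP; apply: Xhom; rewrite -?gX ?glt//.
have ltlr i j : (inl i : osum nat 'I_2) < inr j by [].
have ltll (i j : nat) : (i < j)%N -> (inl i : osum nat 'I_2) < inl j.
  by move=> ij; rewrite lt_neqAle; apply/andP; split; [|exact: ltnW];
    apply/eqP => -[ij']; rewrite ij' ltnn in ij.
pose t0 : osum nat 'I_2 := inr ord0; pose t1 : osum nat 'I_2 := inr ord_max.
have t01 : t0 < t1 by [].
have /choice[N NP] : forall i, exists n, coloured n (g (inl i)) (g t0).
  by move=> i; apply: gc.
have [M MP] := gc _ _ t01.
have NM i : (N i < M)%N.
  have [n' nP] := gc _ _ (ltlr i ord_max).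
  exact: (coloured_triangle (NP i) nP MP).2.
have Nlt i : (N i < N i.+1)%N.
  have [n nP] := gc _ _ (ltll i i.+1 (ltnSn i)).
  by have [<-] := coloured_triangle nP (NP i) (NP i.+1).
have Nge i : (i <= N i)%N by elim: i => // i /leq_ltn_trans; apply.
by have := leq_trans (NM M) (Nge M); rewrite ltnn.
Qed.

Lemma suslin_colouring_no_large (X : set k1) :
  ~ (X #<= [set: k]) -> ~ homogeneous suslin_colouring X false.
Proof.
move=> Xlarge Xhom.
pose X_ s := [set a | X a /\ mkseq (r a) (size s) = s].
pose up z (Y : set k1) := [set a | Y a /\ z <= e a].
have up_le z z' Y : z <= z' -> up z Y #<= [set: k] -> up z' Y #<= [set: k].
  move=> zz'; apply: card_le_trans; apply: subset_card_le => a [Ya za].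
  by split=> //; exact: le_trans za.
pose O s := [set z | up z (X_ s) #<= [set: k] \/
  forall z', z <= z' -> ~ (up z' (X_ s) #<= [set: k])].
(* O s is the dense open set of nodes deciding whether X_ s is small above. *)
have Osmall s : ~` O s #<= [set: k].
  apply: card_setC_dense_open => [z z' [Oz|Oz] zz'|z].
  - by left; exact: up_le Oz.
  - by right=> z'' /(le_trans zz'); exact: Oz.
  case: (pselect (exists2 z', z <= z' & up z' (X_ s) #<= [set: k])) => [[z' zz' h]|h].
    by exists z' => //; left.
  by exists z => //; right=> z' zz' h'; apply: h; exists z'.
(* There are countably many words, so undecided nodes and nodes with few points of [X] above them
   account for at most [k] points. *)
have [a [Xa aO alarge]] : exists a, [/\ X a, forall s, O s (e a)
    & ~ (up (e a) X #<= [set: k])].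
  apply: contrapT => na; apply: Xlarge.
  have : (\bigcup_s [set a | ~ O s (e a)]) `|`
      [set a | X a /\ up (e a) X #<= [set: k]] #<= [set: k].
    apply: card_le_setU => //.
      apply: card_le_bigcup => // [|s _].
        by apply: card_le_trans (countableP _) _.
      apply: card_le_trans (Osmall s).
      by apply: (@card_le_fun _ _ e) => // a b _ _ /e_inj.
    apply: (tree_small_cones (f := e) k_infinite T_tree T_antichain) => a [Xa].
    by apply: card_le_trans; apply: subset_card_le => b [[]].
  apply: card_le_trans; apply: subset_card_le => a Xa; apply: contrapT.
  move=> /not_orP[aO aup]; apply: na; exists a; split=> //.
    by move=> s; apply: contrapT => nO; apply: aO; exists s.
  by move=> h; apply: aup.
(* The word that follows [r a] for [n] places and then leaves it. *)
pose s n := rcons (mkseq (r a) n) (~~ r a n).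
have sE b n : first_difference (r a) (r b) n -> mkseq (r b) n.+1 = s n.
  move=> [ab abn]; rewrite mkseqS; congr rcons.
    by apply/eq_in_map => i; rewrite mem_iota /= => /ab ->.
  by move: abn; case: (r a n); case: (r b n).
have [n nlarge] : exists n, ~ (up (e a) (X_ (s n)) #<= [set: k]).
  apply: contrapT => nn; apply: alarge.
  have : [set a] `|` \bigcup_n up (e a) (X_ (s n)) #<= [set: k].
    apply: card_le_setU => //; first exact: card_le_trans (countable1 a) k_inf.
    apply: card_le_bigcup => // i _; apply: contrapT => ni; apply: nn.
    by exists i.
  apply: card_le_trans; apply: subset_card_le => b [Xb ab].
  have [->|/eqP ba] := eqVneq b a; [by left|right].
  have [|n abn] := @exists_first_difference (r a) (r b).
    by move=> /r_inj ab'; apply: ba.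
  exists n => //; split=> //; split=> //.
  by rewrite size_rcons size_mkseq; exact: sE.
(* [nlarge] rules out the first alternative of [O], so largeness passes up to the node
   [y a (s n)]. *)
have [//|/(_ (y a (s n)) (y_above _ _)) ylarge] := aO (s n).
have [b [[[Xb bs] yb] ab]] : exists b, up (y a (s n)) (X_ (s n)) b /\ a < b.
  apply: contrapT => nb; apply: ylarge; apply: card_le_trans (succ_cardinal_le a k_inf k1_succ).
  apply: subset_card_le => b bP; rewrite /= leNgt; apply/negP => ab.
  by apply: nb; exists b.
have : suslin_colouring a b = false by exact: Xhom.
move/asboolPn; apply; exists n.
rewrite size_rcons size_mkseq in bs.
split; last by rewrite bs.
move: bs; rewrite mkseqS => /rcons_inj[/eq_mkseq_prefix[_ ba] bn].
by split=> [i /ba //|]; rewrite bn; case: (r a n).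
Qed.

End Colouring.

Lemma suslin_not_arrow : [set: k1] #<= continuum ->
  ~ arrow k1 k1 (osum nat 'I_2).
Proof.
move=> /card_leTE[r rinj].
have nlarge : ~ ([set t | large_cone t] #<= [set: k]).
  move=> h; case: k1_succ => _ + _; apply.
  case: T_suslin => _ Tk1 _ _; rewrite -(card_le_eql Tk1).
  have : [set t | large_cone t] `|` [set t | ~ large_cone t] #<= [set: k].
    by apply: card_le_setU => //; exact: card_small_cones.
  apply: card_le_trans; apply: subset_card_le => t _.
  by case: (pselect (large_cone t)); [left|right].
have [//|k1large] := succ_cardinal_dichotomy [set t | large_cone t] k_inf k1_succ.
have [t0 _] : [set t | large_cone t] !=set0.
  by apply/set0P/eqP => l0; apply: nlarge; rewrite l0.
have [e [elarge einj]] := card_leE t0 k1large.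
have /choice[y yP] : forall a, exists y : seq bool -> T,
    (forall s, e a <= y s) /\ forall s s' w, y s <= w -> y s' <= w -> s = s'.
  move=> a; have [y [yge yd]] := large_cone_antichain (elarge a I).
  (* Words are numbered by [pickle] to index the countable antichain. *)
  exists (y \o choice.pickle); split=> [s|s s' w ys ys']; first exact: yge.
  by apply: (pcan_inj choice.pickleK); exact: yd ys ys'.
move=> /(_ (suslin_colouring r e y))[[X [[g [gmono gX]] Xhom]]|[X [Xtype Xhom]]].
  apply: suslin_colouring_no_large Xhom => //.
  - by move=> a b; exact: einj.
  - by move=> a s; have [] := yP a.
  - move=> h; case: k1_succ => _ + _; apply; apply: card_le_trans h.
    apply: (@card_le_fun _ _ g) => [x _|x x' _ _ gg]; first by rewrite -gX; exists x.
    by apply/le_anti; rewrite -(gmono x x') -(gmono x' x) gg lexx.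
apply: suslin_colouring_no_omega2 Xtype Xhom.
- by move=> a s; have [] := yP a.
- by move=> a s s' w; have [_] := yP a; apply.
Qed.

End SuslinColouring.

Theorem theorem3p11
  (dk dk1 dk2 dw1 dS : Order.disp_t)
  (k : orderType dk) (k1 : orderType dk1) (k2 : orderType dk2)
  (w1 : orderType dw1) (S : porderType dS)
  (k_card : is_cardinal k) (k_ge_omega : [set: nat] #<= [set: k])
  (k1_succ : is_succ_cardinal k k1) (k2_succ : is_succ_cardinal k1 k2)
  (w1_succ : is_succ_cardinal nat w1)
  (S_suslin : suslin_tree w1 S)
  (continuum_eq : continuum #= [set: k2])
  (MA_S : MA S)
  (ex_suslin : exists (dT : Order.disp_t) (T : porderType dT), suslin_tree k1 T) :
  arrow_colon k1 k1 nat 'I_2 /\ ~ arrow k1 k1 (osum nat 'I_2).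
Proof.
have [_ k2_gt_k1 _] := k2_succ.
split.
  apply: (MA_arrow_colon k_ge_omega k1_succ w1_succ S_suslin) => //.
    by case: k1_succ.
  by rewrite (card_le_eql continuum_eq).
have [dT [T T_suslin]] := ex_suslin.
apply: (suslin_not_arrow k_ge_omega k1_succ T_suslin).
rewrite (card_le_eqr continuum_eq).
(* The other alternative would embed [k2] in [k1]. *)
by have [//|] := card_le_total [set: k1] [set: k2].
Qed.
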